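(* Let $a_j$, $b_j$ and $c_j$ be rational functions of $j$ with $c_j\not\equiv 0$, and let $\{y_j\}_{j\in\mathbb{N}}$ be a sequence of non-constant rational functions of $z$ solving the equation $$y_{j+1}+y_{j-1}=\frac{a_j y_j^2+b_j y_j+c_j}{y_j^2}.$$ If the degree of $\{y_j\}_{j\in\mathbb{N}}$ grows at most polynomially in $j$, then $a_j=0$, $b_j=Aj+B$ and $c_j=C+D(-1)^j$, where $A$, $B$, $C$ and $D$ are constants.
   Context: Here $j$ is a discrete (integer) index and $z$ is an external complex variable: each $y_j=y_j(z)$ is a rational function of $z$ with complex coefficients, while the coefficients $a_j,b_j,c_j$ are complex numbers independent of $z$, given by evaluating fixed rational functions at $j$. The equation is an identity between rational functions of $z$, for each $j$ such that $j-1,j,j+1\in\mathbb{N}$. The degree $\deg_z(y_j)$ of a non-constant rational function $y_j$ is its degree as a map $\mathbb{CP}^1\to\mathbb{CP}^1$, i.e. its number of zeros (equivalently, poles) in $\mathbb{CP}^1$ counted with multiplicity. ''The degree grows at most polynomially in $j$'' means that $\deg_z(y_j)$ is bounded above by a polynomial in $j$. *)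

(* Defs.v *)
From mathcomp Require Import all_boot all_order all_algebra.
From mathcomp Require Import fraction complex.
From mathcomp Require Import classical_sets fsbigop reals.
Set Implicit Arguments.
Unset Strict Implicit.
Unset Printing Implicit Defensive.
Import GRing.Theory Num.Theory.
Local Open Scope classical_set_scope.
Local Open Scope ring_scope.

Section RationalFunctions.
Variable K : fieldType.

Definition ratfun : Type := {fraction {poly K}}.

Definition ratconst (k : K) : ratfun := tofrac k%:P.

Definition nonconstant (f : ratfun) : Prop := forall k : K, f <> ratconst k.

(* The representative of a fraction need not be in lowest terms, so that f is
   regular at x as soon as some representation has a nonvanishing denominator
   there. The value v is then unique; if f has a pole at x there is none. *)
Definition has_value (f : ratfun) (x v : K) : Prop :=
  exists p q : {poly K},
    [/\ f = tofrac p / tofrac q, q.[x] != 0 & v = p.[x] / q.[x]].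

(* Order of vanishing of f <> 0 at a point of the projective line (None is the
   point at infinity), taken to be 0 where f does not vanish. The order of p/q
   is mup x p - mup x q at x, and deg q - deg p at infinity, whether or not
   p and q are coprime; the subtraction of nat truncates negative orders,
   i.e. poles. *)
Definition zero_mult (f : ratfun) (P : option K) : nat :=
  let p := \n_(repr f) in
  let q := \d_(repr f) in
  if P is Some x then (mup x p - mup x q)%N else (size q - size p)%N.

(* Meaningful for f <> 0, where the sum has finite support. *)
Definition ratdeg (f : ratfun) : nat :=
  \big[addn/0%N]_(P \in [set: option K]) zero_mult f P.

End RationalFunctions.

(* Main.v *)
Require Import Defs.
From HB Require Import structures.
From mathcomp Require Import all_boot all_order all_algebra.
From mathcomp Require Import fraction complex reals.
From mathcomp Require Import boolp classical_sets fsbigop.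
From mathcomp Require Import zify ring.
Import Order.TTheory GRing.Theory Num.Theory.
Local Open Scope ring_scope.
Set Implicit Arguments.
Unset Strict Implicit.
Unset Printing Implicit Defensive.

(** The proof is a quantitative singularity confinement argument. Write d_j for
    the degree of y_j, and, at a point P of the projective line, z_j and p_j for
    the multiplicities of y_j as a zero and as a pole.

    If y_j vanishes to order m at P, the term c_j / y_j^2 forces a pole of order
    2m at y_(j-1) or y_(j+1) ([zero_le_poles]). As the degree counts the zeros
    and also counts the poles, summing over P gives 2 d_j <= d_(j-1) + d_(j+1).
    The slack of this inequality is at least the sum over P of
    min(p_(j-1), p_(j+1)), so it is large as soon as many points carry poles on
    both sides of index j.

    Follow a zero u = y_j of order m whose predecessor y_(j-1) has a pole of order
    less than m. Then y_(j+1) ~ c_j / u^2, and y_(j+2) = a_(j+1) - u + ..., and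
    y_(j+3) has again a pole of order less than m only if the expansions in u
    match, which requires a_(j+1) = 0, c_(j+2) = c_j and
    b_j + b_(j+2) = 2 b_(j+1) ([confinement]). When these conditions fail at every
    large index, y_(j+3) has a pole of order at least m, as y_(j+1) does, and the
    zero at j is paid for by the slack at j + 2; by time reversal, a zero whose
    successor has no large pole is paid for by the slack at j - 2; in the
    remaining case the slack at j suffices. Hence d_j is at most the sum of the
    slacks at j - 2, j and j + 2 ([degree_window]). Together with convexity this
    makes the degree double every three steps ([convex_doubling]), which no
    polynomial bound allows.

    So the three confinement conditions hold for infinitely many j. Each says
    that a rational function of j vanishes, so they hold for all large j: a
    vanishes, b has zero second difference, and c has period two. A rational
    function agreeing with a polynomial at infinitely many integers is that
    polynomial ([ratfun_seq_poly]), which makes b affine and c constant; the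
    amplitude D of the alternating part is therefore 0. *)

(** * Valuations and the local expansion at a zero *)

Record valuation (k F : fieldType) (kappa : {rmorphism k -> F}) (v : F -> int)
    : Prop := Valuation {
  valM : forall f g, f != 0 -> g != 0 -> v (f * g) = v f + v g;
  valD : forall f g, f != 0 -> g != 0 -> f + g != 0 ->
    Num.min (v f) (v g) <= v (f + g);
  valC : forall a, a != 0 -> v (kappa a) = 0 }.

(** Order at least n, with 0 having infinite order: the integer v 0 cannot express
    that, so [valuation] speaks of nonzero elements and 0 is added here. *)
Definition ordge (F : fieldType) (v : F -> int) (n : int) (f : F) : bool :=
  (f == 0) || (n <= v f).

Section Valuation.
Variables (k F : fieldType) (kappa : {rmorphism k -> F}) (v : F -> int).
Hypothesis vP : valuation kappa v.
Local Notation O := (ordge v).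

Lemma ordgeW n m f : m <= n -> O n f -> O m f.
Proof. by rewrite /ordge => le_mn /orP[->//|?]; apply/orP; right; lia. Qed.

Lemma ordgeD n f g : O n f -> O n g -> O n (f + g).
Proof.
rewrite /ordge => Hf Hg.
have [f0|f0] := eqVneq f 0; first by rewrite f0 add0r.
have [g0|g0] := eqVneq g 0; first by rewrite g0 addr0.
have [//|fg0] := eqVneq (f + g) 0.
move: Hf Hg; rewrite (negPf f0) (negPf g0) /= => Hf Hg.
by apply: le_trans (valD vP f0 g0 fg0); rewrite le_min Hf.
Qed.

Lemma ordgeM n m f g : O n f -> O m g -> O (n + m) (f * g).
Proof.
rewrite /ordge mulf_eq0 => Hf Hg.
have [//|f0] := eqVneq f 0; have [//|g0] := eqVneq g 0.
move: Hf Hg; rewrite (valM vP f0 g0) (negPf f0) (negPf g0) /=; lia.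
Qed.

Lemma ordge_const a : O 0 (kappa a).
Proof.
have [->|a0] := eqVneq a 0; first by rewrite /ordge rmorph0 eqxx.
by rewrite /ordge (valC vP) // lexx orbT.
Qed.

Lemma ordge_const_eq0 n a : 0 < n -> O n (kappa a) -> a = 0.
Proof.
move=> n0; have [//|a0] := eqVneq a 0.
by rewrite /ordge (valC vP) // fmorph_eq0 (negPf a0) /=; lia.
Qed.

Lemma ordgeN n f : O n (- f) = O n f.
Proof.
suff H g : O n g -> O n (- g) by apply/idP/idP => [/H|/H //]; rewrite opprK.
by move=> Hg; rewrite -mulN1r -[n]add0r -(rmorphN1 kappa); apply/ordgeM/Hg/ordge_const.
Qed.

Lemma ordgeB n f g : O n f -> O n g -> O n (f - g).
Proof. by move=> Hf Hg; apply: ordgeD => //; rewrite ordgeN. Qed.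

Lemma ordgeMl n f a : O n f -> O n (kappa a * f).
Proof. by move=> Hf; rewrite -[n]add0r; apply/ordgeM/Hf/ordge_const. Qed.

Lemma valV f : f != 0 -> v f^-1 = - v f.
Proof.
move=> f0; have := valM vP f0 (invr_neq0 f0).
have := valC vP (oner_neq0 k); rewrite rmorph1 mulfV // => ->; lia.
Qed.

Lemma ordge_val n f : n <= v f -> O n f.
Proof. by rewrite /ordge => ->; rewrite orbT. Qed.

Lemma val_ordge n f : f != 0 -> O n f -> n <= v f.
Proof. by rewrite /ordge => /negPf ->. Qed.

Lemma val_near_const n f a : 0 < n -> a != 0 -> O n (f - kappa a) ->
  f != 0 /\ v f = 0.
Proof.
move=> n0 a0 Hf.
have f0 : f != 0.
  apply/eqP => f0; move: Hf; rewrite f0 sub0r ordgeN => /(ordge_const_eq0 n0).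
  by move/eqP; apply/negP.
split=> //.
have ge0 : 0 <= v f.
  apply: val_ordge => //; rewrite -[f](subrK (kappa a)).
  by apply: ordgeD (ordge_const a); apply: ordgeW Hf; lia.
have [//|] : v f = 0 \/ 1 <= v f by lia.
move=> /ordge_val H1; case/eqP: a0; apply: (@ordge_const_eq0 1) => //.
rewrite (_ : kappa a = f - (f - kappa a)); last by ring.
by apply: ordgeB => //; apply: ordgeW Hf; lia.
Qed.

Definition recurrence_rhs (a b c : k) (u : F) : F :=
  (kappa a * u ^+ 2 + kappa b * u + kappa c) / u ^+ 2.

(** The constant c equals u^2 (y + x) - a u^2 - b u; if both poles had order
    less than 2 v(u), it would have positive order. *)
Lemma zero_doubles_pole a b c x u y :
  c != 0 -> u != 0 -> 0 < v u -> y + x = recurrence_rhs a b c u ->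
  O (1 - v u *+ 2) x -> O (1 - v u *+ 2) y -> False.
Proof.
move=> c0 u0 m0 E Hx Hy; case/eqP: (c0).
apply: (@ordge_const_eq0 1) => //.
have Hu : O (v u) u by exact: ordge_val.
have -> : kappa c = u * u * (y + x) - kappa a * (u * u) - kappa b * u.
  by rewrite E /recurrence_rhs; field.
have Hu2 := ordgeM Hu Hu.
apply: ordgeB; last by apply: ordgeMl; apply: ordgeW Hu; lia.
apply: ordgeB; last by apply: ordgeMl; apply: ordgeW Hu2; lia.
by apply: ordgeW (ordgeM Hu2 (ordgeD Hy Hx)); lia.
Qed.

(** The first two terms of the expansion of u^2 y at a zero u. They survive as long
    as x has a pole of order less than v(u), since x then enters at order
    v(u) + 1 only. *)
Lemma zero_expansion a b c x u y : u != 0 -> 0 < v u ->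
  y + x = recurrence_rhs a b c u -> O (1 - v u) x ->
  O (v u + 1) (u ^+ 2 * y - kappa c - kappa b * u).
Proof.
move=> u0 m0 E Hx.
have Hu : O (v u) u by exact: ordge_val.
have Hu2 := ordgeM Hu Hu.
have -> : u ^+ 2 * y - kappa c - kappa b * u = kappa a * (u * u) - x * (u * u).
  by rewrite -[y](addrK x) E /recurrence_rhs; field.
apply: ordgeB; first by apply: ordgeMl; apply: ordgeW Hu2; lia.
by apply: ordgeW (ordgeM Hx Hu2); lia.
Qed.

(** Five consecutive terms x, u, y, w, t, with u a zero and small poles at both
    ends. The middle equation makes y^-1 small, so w = a2 - u + (b2/c1) u^2 + ...,
    and w must itself be a zero, for otherwise its neighbours y and t would have
    poles of the same order. Both u^2 y = c1 + b1 u + ... and w^2 y = c3 + b3 w + ...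
    then hold, and substituting the first expansion of w in the second one leaves
    the two compatibility conditions at orders 0 and v(u). *)
Lemma confinement a1 b1 c1 a2 b2 c2 a3 b3 c3 x u y w t :
    c1 != 0 -> u != 0 -> y != 0 -> w != 0 -> 0 < v u ->
    y + x = recurrence_rhs a1 b1 c1 u ->
    w + u = recurrence_rhs a2 b2 c2 y ->
    t + y = recurrence_rhs a3 b3 c3 w ->
    O (1 - v u) x -> O (1 - v u) t ->
  [/\ a2 = 0, c3 = c1 & b1 + b3 = b2 *+ 2].
Proof.
move=> c10 u0 y0 w0 m0 E1 E2 E3 Hx Ht.
have H1 := zero_expansion u0 m0 E1 Hx.
have [m Eu] : exists m, v u = m by exists (v u).
rewrite Eu in m0 Hx Ht H1.
have Hu : O m u by apply: ordge_val; rewrite Eu.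
have Hu2 : O (m *+ 2) (u ^+ 2) := ordgeM Hu Hu.
have H1' : O m (u ^+ 2 * y - kappa c1).
  rewrite -[X in O m X](subrK (kappa b1 * u)).
  by apply: ordgeD; [apply: ordgeW H1; clear -m0; lia | exact: ordgeMl].
have u20 : u ^+ 2 != 0 by rewrite expf_neq0.
have vy : v y = - (m *+ 2).
  have [_] := val_near_const m0 c10 H1'.
  by rewrite (valM vP) // expr2 (valM vP) // Eu; clear -m0; lia.
have Hy : O (- (m *+ 2)) y by apply: ordge_val; rewrite vy.
have Hyi : O (m *+ 2) y^-1 by apply: ordge_val; rewrite valV // vy; clear -m0; lia.
have kc10 : kappa c1 != 0 by rewrite fmorph_eq0.
have H2 : O (m *+ 3) (y^-1 - u ^+ 2 / kappa c1).
  have -> : y^-1 - u ^+ 2 / kappa c1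
      = - (kappa c1^-1 * ((u ^+ 2 * y - kappa c1) * y^-1)).
    by rewrite fmorphV; field; rewrite y0.
  by rewrite ordgeN; apply: ordgeMl; apply: ordgeW (ordgeM H1' Hyi); clear -m0; lia.
have Ew : w = kappa a2 + kappa b2 * y^-1 + kappa c2 * (y^-1 * y^-1) - u.
  by rewrite -[w](addrK u) E2 /recurrence_rhs; field.
have Hyi2 := ordgeM Hyi Hyi.
(* If a2 <> 0 then w is a unit, and the last equation bounds the pole of y by
   that of t, against v(y) = -2m. *)
have a20 : a2 = 0.
  apply/eqP/negPn/negP => a20.
  have Hw : O m (w - kappa a2).
    rewrite (_ : _ - _ = kappa b2 * y^-1 + kappa c2 * (y^-1 * y^-1) - u); last first.
      by rewrite Ew; ring.
    apply: ordgeB => //; apply: ordgeD; apply: ordgeMl.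
      by apply: ordgeW Hyi; clear -m0; lia.
    by apply: ordgeW Hyi2; clear -m0; lia.
  have [_ vw] := val_near_const m0 a20 Hw.
  have Hwi : O 0 w^-1 by apply: ordge_val; rewrite valV // vw.
  suff : 1 - m <= v y by rewrite vy; clear -m0; lia.
  apply: val_ordge => //.
  have -> : y = kappa a3 + kappa b3 * w^-1 + kappa c3 * (w^-1 * w^-1) - t.
    by rewrite -[y](addKr t) E3 /recurrence_rhs; field.
  apply: ordgeB => //; apply: (@ordgeW 0); first by clear -m0; lia.
  apply: ordgeD; last by apply: ordgeMl; rewrite -[0]addr0; exact: ordgeM.
  by apply: ordgeD; [exact: ordge_const | exact: ordgeMl].
rewrite a20 rmorph0 add0r in Ew.
pose r := w + u - kappa (b2 / c1) * u ^+ 2.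
have H3 : O (m *+ 3) r.
  have -> : r = kappa b2 * (y^-1 - u ^+ 2 / kappa c1) + kappa c2 * (y^-1 * y^-1).
    by rewrite /r Ew fmorph_div; field; rewrite y0.
  apply: ordgeD; first exact: ordgeMl.
  by apply: ordgeMl; apply: ordgeW Hyi2; clear -m0; lia.
have Hwu : O (m *+ 2) (w + u).
  rewrite -[w + u](subrK (kappa (b2 / c1) * u ^+ 2)).
  by apply: ordgeD; [apply: ordgeW H3; clear -m0; lia | exact: ordgeMl].
have Hw : O m w.
  by rewrite -[w](addrK u); apply: ordgeB => //; apply: ordgeW Hwu; clear -m0; lia.
have Hw2 := ordgeM Hw Hw.
have H4 : O (m + 1) (w ^+ 2 * y - kappa c3 - kappa b3 * w).
  have -> : w ^+ 2 * y - kappa c3 - kappa b3 * w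
      = kappa a3 * (w * w) - t * (w * w).
    by rewrite -[y](addKr t) E3 /recurrence_rhs; field.
  apply: ordgeB; first by apply: ordgeMl; apply: ordgeW Hw2; clear -m0; lia.
  by apply: ordgeW (ordgeM Ht Hw2); clear -m0; lia.
(* Squaring w = -u + (b2/c1) u^2 + r, with the u^4 term absorbed in the error. *)
have H5 : O (m *+ 4) (w ^+ 2 - u ^+ 2 + kappa (b2 / c1) * u ^+ 3 *+ 2).
  have -> : w ^+ 2 - u ^+ 2 + kappa (b2 / c1) * u ^+ 3 *+ 2
      = r * (w - u + kappa (b2 / c1) * u ^+ 2)
        + kappa ((b2 / c1) ^+ 2) * (u ^+ 2 * u ^+ 2).
    by rewrite /r !rmorphXn /=; ring.
  apply: ordgeD; last by apply: ordgeMl; apply: ordgeW (ordgeM Hu2 Hu2); clear -m0; lia.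
  have Hs : O m (w - u + kappa (b2 / c1) * u ^+ 2).
    by apply: ordgeD; [exact: ordgeB | apply: ordgeMl; apply: ordgeW Hu2; clear -m0; lia].
  by apply: ordgeW (ordgeM H3 Hs); clear -m0; lia.
have H6 : O (m + 1) (w ^+ 2 * y - kappa c1 - kappa (b1 - b2 *+ 2) * u).
  have -> : w ^+ 2 * y - kappa c1 - kappa (b1 - b2 *+ 2) * u
      = (w ^+ 2 - u ^+ 2 + kappa (b2 / c1) * u ^+ 3 *+ 2) * y
        + (u ^+ 2 * y - kappa c1 - kappa b1 * u)
        - kappa (b2 / c1 *+ 2) * (u * (u ^+ 2 * y - kappa c1)).
    by rewrite rmorphB !rmorphMn fmorph_div /=; field.
  apply: ordgeB; last by apply: ordgeMl; apply: ordgeW (ordgeM Hu H1'); clear -m0; lia.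
  by apply: ordgeD => //; apply: ordgeW (ordgeM H5 Hy); clear -m0; lia.
(* H4 and H6 expand the same element w^2 y; compare them at order 0, then, with
   w = -u up to order 2m, at order m. *)
have c31 : c3 = c1.
  apply/eqP; rewrite -subr_eq0; apply/eqP; apply: (ordge_const_eq0 m0).
  have -> : kappa (c3 - c1) = (w ^+ 2 * y - kappa c1 - kappa (b1 - b2 *+ 2) * u)
     - (w ^+ 2 * y - kappa c3 - kappa b3 * w)
     + kappa (b1 - b2 *+ 2) * u - kappa b3 * w.
    by rewrite rmorphB; ring.
  apply: ordgeB (ordgeMl _ Hw); apply: ordgeD (ordgeMl _ Hu).
  by apply: ordgeB; [apply: ordgeW H6 | apply: ordgeW H4]; clear -m0; lia.
split=> //; apply/eqP; rewrite -subr_eq0; apply/eqP.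
apply: (@ordge_const_eq0 1) => //.
have -> : kappa (b1 + b3 - b2 *+ 2)
    = ((w ^+ 2 * y - kappa c3 - kappa b3 * w)
       - (w ^+ 2 * y - kappa c1 - kappa (b1 - b2 *+ 2) * u)
       + kappa b3 * (w + u)) * u^-1.
  by rewrite c31 !rmorphB rmorphD rmorphMn /=; field.
have Hui : O (- m) u^-1 by apply: ordge_val; rewrite valV // Eu.
rewrite -[1](addKr m) addrC; apply: ordgeM Hui.
apply: ordgeD; first exact: ordgeB.
by apply: ordgeMl; apply: ordgeW Hwu; clear -m0; lia.
Qed.
End Valuation.

(** * Orders of zeros and poles on the projective line *)

HB.instance Definition _ (K : fieldType) := GRing.RMorphism.copy (@ratconst K)
  (@FracField.tofrac {poly K} \o polyC).

Section Order.
Variable K : fieldType.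
Local Notation tofrac := (@FracField.tofrac {poly K}).

(** Typed as polynomials, rather than as elements of the integral domain underlying
    the fractions, so that lemmas about polynomials rewrite in them. *)
Definition rnum (f : ratfun K) : {poly K} := \n_(repr f).
Definition rden (f : ratfun K) : {poly K} := \d_(repr f).

Lemma rden_neq0 f : rden f != 0.
Proof. exact: denom_ratioP. Qed.

Lemma ratfunE (f : ratfun K) :
  f = tofrac (rnum f) / tofrac (rden f).
Proof.
rewrite -[LHS]reprK /rnum /rden; set x := repr f.
have d0 : tofrac \d_x != 0 by rewrite tofrac_eq0 denom_ratioP.
apply: (mulIf d0); rewrite divfK //.
rewrite !piE; apply/eqmodP; rewrite /= FracField.equivfE /FracField.mulf.
by rewrite !numden_Ratio ?mulf_neq0 ?oner_neq0 ?denom_ratioP // !mulr1 mulrC.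
Qed.

Lemma rnum_neq0 (f : ratfun K) : f != 0 -> (rnum f) != 0.
Proof.
by apply: contra_neq => n0; rewrite [f]ratfunE n0 tofrac0 mul0r.
Qed.

(** At infinity the valuation of a polynomial is minus its degree, that is
    1 - size p for p <> 0. *)
Definition pord (P : option K) (p : {poly K}) : int :=
  if P is Some x then (mup x p)%:Z else 1 - (size p)%:Z.

Definition ord (P : option K) (f : ratfun K) : int :=
  pord P (rnum f) - pord P (rden f).

Lemma pordM P (p q : {poly K}) : p != 0 -> q != 0 -> pord P (p * q) = pord P p + pord P q.
Proof.
case: P => [x|] p0 q0 /=; first by rewrite mupM.
move: p0 q0 (size_mul p0 q0); rewrite -!size_poly_gt0 => p0 q0 ->.
by rewrite /= in p0 q0 *; move: (size p) (size q) p0 q0 => a b; lia.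
Qed.

Lemma pordD P n (p q : {poly K}) : p + q != 0 -> p != 0 -> q != 0 ->
  n <= pord P p -> n <= pord P q -> n <= pord P (p + q).
Proof.
case: P => [x|] pq0 p0 q0 /=.
  case: n => [n|n]; last by [].
  by rewrite !lez_nat !mup_geq // => *; rewrite dvdp_add.
move: (size_polyD p q); move: (size (p + q)) (size p) (size q) => a b c; lia.
Qed.

(** The order does not depend on the fraction chosen, which is how it is computed
    for sums and products, whose chosen representatives are unknown. *)
Lemma ord_frac P (p q : {poly K}) : p != 0 -> q != 0 ->
  ord P (tofrac p / tofrac q) = pord P p - pord P q.
Proof.
move=> p0 q0; set f := _ / _.
have f0 : f != 0 by rewrite mulf_neq0 ?invr_eq0 ?tofrac_eq0.
have n0 := rnum_neq0 f0; have d0 := rden_neq0 f.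
have /(congr1 (pord P)) : (rnum f) * q = p * (rden f).
  apply/eqP; rewrite -tofrac_eq !tofracM; apply/eqP.
  have := ratfunE f; rewrite {1}/f => /eqP.
  by rewrite eqr_div ?tofrac_eq0 // => /eqP ->.
by rewrite (pordM P n0 q0) (pordM P p0 d0) /ord; lia.
Qed.

Lemma ord_valuation P : valuation (@ratconst K) (ord P).
Proof.
split=> [f g f0 g0|f g f0 g0|a a0].
- have nf := rnum_neq0 f0; have ng := rnum_neq0 g0.
  have -> : f * g = tofrac (rnum f * rnum g) / tofrac (rden f * rden g).
    by rewrite [f in LHS]ratfunE [g in LHS]ratfunE mulf_div !tofracM.
  by rewrite ord_frac ?mulf_neq0 ?rden_neq0 // !pordM ?rden_neq0 // opprD addrACA.
- have nf := rnum_neq0 f0; have ng := rnum_neq0 g0.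
  have df := rden_neq0 f; have dg := rden_neq0 g.
  have -> : f + g = tofrac (rnum f * rden g + rnum g * rden f)
                  / tofrac (rden f * rden g).
    rewrite [f in LHS]ratfunE [g in LHS]ratfunE addf_div ?tofrac_eq0 //.
    by rewrite tofracD !tofracM.
  move=> fg0; have n0 : rnum f * rden g + rnum g * rden f != 0.
    by apply: contra_neq fg0 => ->; rewrite tofrac0 mul0r.
  have nd := mulf_neq0 nf dg; have dn := mulf_neq0 ng df.
  rewrite ord_frac ?mulf_neq0 // ge_min.
  have [le|/ltW le] := leP (pord P (rnum f * rden g)) (pord P (rnum g * rden f)).
    have := pordD n0 nd dn (lexx _) le.
    by rewrite !pordM // => le'; rewrite lerBrDr addrA subrK le'.
  have := pordD n0 nd dn le (lexx _).
  rewrite !pordM // => le'; apply/orP; right.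
  by rewrite lerBrDr (addrC (pord P (rden f))) addrA subrK.
- suff: ord P (tofrac a%:P / tofrac (1%:P)) = 0 by rewrite tofrac1 divr1.
  rewrite ord_frac ?polyC_eq0 ?oner_neq0 //.
  case: P => [x|] /=; last by rewrite !size_polyC oner_neq0 a0; lia.
  by rewrite !mupNroot ?rootC ?oner_neq0.
Qed.

Definition pole_mult (f : ratfun K) (P : option K) : nat :=
  let p := (rnum f) in
  let q := (rden f) in
  if P is Some x then (mup x q - mup x p)%N else (size p - size q)%N.

Lemma ord_zero_pole f P : ord P f = (zero_mult f P)%:Z - (pole_mult f P)%:Z.
Proof.
have H (m n : nat) : m%:Z - n%:Z = (m - n)%N%:Z - (n - m)%N%:Z by lia.
case: P => [x|]; first exact: H.
by rewrite /ord /= opprB addrC subrKA; exact: H.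
Qed.

Lemma zero_or_pole f P : zero_mult f P = 0%N \/ pole_mult f P = 0%N.
Proof.
have H (m n : nat) : (m - n = 0 \/ n - m = 0)%N by lia.
by case: P => [x|]; exact: H.
Qed.

End Order.

(** * The degree counts the zeros, and also the poles *)

Section Degree.
Variable K : closedFieldType.

Lemma mup_roots (p : {poly K}) : p != 0 ->
  exists2 r : seq K, p = lead_coef p *: \prod_(z <- r) ('X - z%:P)
                   & forall x, mup x p = count_mem x r.
Proof.
move=> p0; have [r Er] := closed_field_poly_normal p; exists r => // x.
rewrite {1}Er -mul_polyC mupMr ?mu_prod_XsubC //.
by rewrite /root hornerC lead_coef_eq0.
Qed.

Lemma sum_mup (p : {poly K}) (S : seq K) : p != 0 -> uniq S ->
  (forall x, root p x -> x \in S) -> (\sum_(x <- S) mup x p = (size p).-1)%N.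
Proof.
move=> p0 uS rS; have [r Er mupE] := mup_roots p0.
have -> : (size p).-1 = size r.
  by rewrite {1}Er size_scale ?lead_coef_eq0 // size_prod_XsubC.
have rSr : {subset r <= S}.
  by move=> x xr; apply: rS; rewrite Er rootZ ?lead_coef_eq0 // root_prod_XsubC.
under eq_bigr do rewrite mupE -sum1_count big_mkcond.
rewrite exchange_big /= -sum1_size big_seq [RHS]big_seq.
apply: eq_bigr => y yr; rewrite -big_mkcond /= sum1_count.
under eq_count do rewrite /= eq_sym.
by rewrite count_uniq_mem // rSr.
Qed.

Lemma sum_line (S : seq (option K)) (g : option K -> nat) : uniq S -> None \in S ->
  (\sum_(P <- S) g P = g None + \sum_(x <- pmap id S) g (Some x))%N.
Proof.
move=> uS NS; rewrite (perm_big (None :: map Some (pmap id S))).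
  by rewrite big_cons big_map.
apply: uniq_perm => //=.
  rewrite map_inj_uniq; last by move=> x y [].
  rewrite (@pmap_uniq _ _ _ Some) //; last by move=> x; case: x.
  by rewrite andbT; apply/negP => /mapP[].
case=> [x|]; last by rewrite NS in_cons eqxx.
by rewrite in_cons /= mem_map ?mem_pmap ?map_id //; move=> ? ? [].
Qed.

(** The degree is a sum over any large enough finite set of points, which lets
    degrees of several functions be compared point by point. Zeros and poles
    balance because the number of roots of a polynomial is its degree and the
    difference of the two degrees is accounted for at infinity. *)
Lemma ratdeg_sum (f : ratfun K) : f != 0 ->
  exists r : seq (option K), forall S, uniq S -> {subset r <= S} ->
    ratdeg f = (\sum_(P <- S) zero_mult f P)%N /\
    ratdeg f = (\sum_(P <- S) pole_mult f P)%N.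
Proof.
move=> f0; have n0 := rnum_neq0 f0; have d0 := rden_neq0 f.
set n := (rnum f) in n0; set d := (rden f) in d0.
have [rn Ern _] := mup_roots n0; have [rd Erd _] := mup_roots d0.
exists (None :: map Some (rn ++ rd)) => S uS rS.
have NS : None \in S by rewrite rS // in_cons eqxx.
have rnS x : root n x -> Some x \in S.
  rewrite Ern rootZ ?lead_coef_eq0 // root_prod_XsubC => xr.
  by rewrite rS // in_cons /= map_f // mem_cat xr.
have rdS x : root d x -> Some x \in S.
  rewrite Erd rootZ ?lead_coef_eq0 // root_prod_XsubC => xr.
  by rewrite rS // in_cons /= map_f // mem_cat xr orbT.
have Ez : ratdeg f = (\sum_(P <- S) zero_mult f P)%N.
  rewrite /ratdeg; rewrite (fsbigE S) //=.
    by apply: eq_bigl => P; rewrite in_setT.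
  case=> [x|] _ xS; last by rewrite NS in xS.
  rewrite /= mupNroot ?sub0n //; apply: contra xS; exact: rnS.
split=> //; rewrite Ez.
have uS' : uniq (pmap id S) by apply: (@pmap_uniq _ _ _ Some) => // -[].
have memS' x : (x \in pmap id S) = (Some x \in S) by rewrite mem_pmap map_id.
have Hn := sum_mup n0 uS' (fun x rx => etrans (memS' x) (rnS x rx)).
have Hd := sum_mup d0 uS' (fun x rx => etrans (memS' x) (rdS x rx)).
(* The multiplicity of zeros is the truncated difference A - B and that of poles
   is B - A, and A and B have the same total size n + size d - 1. *)
pose A P := if P is Some x then mup x n else size d.
pose B P := if P is Some x then mup x d else size n.
have EAB : (\sum_(P <- S) A P = \sum_(P <- S) B P)%N.
  rewrite !sum_line //= Hn Hd.
  by move: n0 d0; rewrite -!size_poly_gt0; move: (size n) (size d) => i j; lia.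
have H (i j : nat) : (i - j + j = j - i + i)%N by lia.
have : (\sum_(P <- S) zero_mult f P + \sum_(P <- S) B P
      = \sum_(P <- S) pole_mult f P + \sum_(P <- S) A P)%N.
  rewrite -!big_split /=; by apply: eq_bigr => -[x|] _; exact: H.
by rewrite EAB => /addIn.
Qed.

(** Without zeros and poles, numerator and denominator have the same roots with the
    same multiplicities, so they are proportional. *)
Lemma ratdeg_gt0 (f : ratfun K) : nonconstant f -> (0 < ratdeg f)%N.
Proof.
move=> ncf; have f0 : f != 0.
  by apply/eqP => f0; apply: (ncf 0); rewrite f0 rmorph0.
rewrite lt0n; apply/eqP => deg0.
have n0 := rnum_neq0 f0; have d0 := rden_neq0 f.
have [r Hr] := ratdeg_sum f0.
have mupE x : mup x (rnum f) = mup x (rden f).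
  have [||Hz Hp] := Hr (undup (Some x :: r)); first exact: undup_uniq.
    by move=> P Pr; rewrite mem_undup in_cons Pr orbT.
  have xS : Some x \in undup (Some x :: r) by rewrite mem_undup mem_head.
  have z0 : zero_mult f (Some x) = 0%N.
    apply/eqP; move/esym/eqP: Hz; rewrite deg0 sum_nat_seq_eq0.
    by move=> /allP/(_ _ xS).
  have p0 : pole_mult f (Some x) = 0%N.
    apply/eqP; move/esym/eqP: Hp; rewrite deg0 sum_nat_seq_eq0.
    by move=> /allP/(_ _ xS).
  by apply/eqP; rewrite eqn_leq -!subn_eq0; apply/andP; split; apply/eqP.
have [rn Ern Mn] := mup_roots n0; have [rd Erd Md] := mup_roots d0.
have rnd : perm_eq rn rd.
  by apply/allP => x _ /=; rewrite -Mn -Md mupE.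
apply: (ncf (lead_coef (rnum f) / lead_coef (rden f))).
rewrite [LHS]ratfunE Ern Erd (perm_big _ rnd) /= -!mul_polyC !tofracM.
have prod0 : FracField.tofrac (\prod_(z <- rd) ('X - z%:P)) != 0.
  by rewrite tofrac_eq0 monic_neq0 // monic_prod_XsubC.
rewrite !lead_coefM !lead_coefC !(monicP (monic_prod_XsubC _ _ _)) !mulr1.
by rewrite -mulf_div divff // mulr1 fmorph_div.
Qed.
End Degree.

(** * Zeros force poles *)

Section LocalCounts.
Variable K : fieldType.
Implicit Types (x u y w t : ratfun K) (P : option K).
Local Notation rhs := (recurrence_rhs (@ratconst K)).

Lemma ordge_pole P f (n : nat) : (pole_mult f P <= n)%N ->
  ordge (ord P) (- n%:Z) f.
Proof.
move=> le_pn; apply: ordge_val; rewrite ord_zero_pole.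
move: (zero_mult f P) (pole_mult f P) le_pn => z p; lia.
Qed.

Lemma ord_zero P f : (0 < zero_mult f P)%N -> ord P f = (zero_mult f P)%:Z.
Proof.
move=> z0; rewrite ord_zero_pole; case: (zero_or_pole f P) => e.
  by rewrite e in z0.
by rewrite e subr0.
Qed.

Lemma zero_le_poles P a b c x u y : c != 0 -> u != 0 -> y + x = rhs a b c u ->
  (2 * zero_mult u P <= maxn (pole_mult x P) (pole_mult y P))%N.
Proof.
move=> c0 u0 E; have [->//|z0] := posnP (zero_mult u P).
have Eu := ord_zero z0; rewrite leqNgt gtn_max; apply/negP => /andP[px py].
have lower f : (pole_mult f P < 2 * zero_mult u P)%N ->
    ordge (ord P) (1 - ord P u *+ 2) f.
  move=> pf; rewrite Eu.
  apply: (@ordgeW _ _ (- ((2 * zero_mult u P).-1)%:Z)).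
    by move: (zero_mult u P) z0; lia.
  by apply: ordge_pole; move: (pole_mult f P) (zero_mult u P) z0 pf; lia.
apply: (zero_doubles_pole (ord_valuation P) c0 u0 _ E); try exact: lower.
by rewrite Eu.
Qed.

(** The contrapositive of [confinement]: when the conditions fail, the pole next to
    the zero u recurs beyond w, unless there was already one before u. *)
Lemma unconfined_pole P a1 b1 c1 a2 b2 c2 a3 b3 c3 x u y w t :
    c1 != 0 -> u != 0 -> y != 0 -> w != 0 ->
    y + x = rhs a1 b1 c1 u -> w + u = rhs a2 b2 c2 y -> t + y = rhs a3 b3 c3 w ->
    ~ [/\ a2 = 0, c3 = c1 & b1 + b3 = b2 *+ 2] ->
  (zero_mult u P <= maxn (pole_mult x P) (pole_mult t P))%N.
Proof.
move=> c10 u0 y0 w0 E1 E2 E3 nconf.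
have [->//|z0] := posnP (zero_mult u P).
have Eu := ord_zero z0; rewrite leqNgt gtn_max; apply/negP => /andP[px pt].
have lower f : (pole_mult f P < zero_mult u P)%N ->
    ordge (ord P) (1 - ord P u) f.
  move=> pf; rewrite Eu; apply: (@ordgeW _ _ (- ((zero_mult u P).-1)%:Z)).
    by move: (zero_mult u P) z0; lia.
  by apply: ordge_pole; move: (pole_mult f P) (zero_mult u P) z0 pf; lia.
apply: nconf; apply: (confinement (ord_valuation P) c10 u0 y0 w0 _ E1 E2 E3);
  try exact: lower.
by rewrite Eu.
Qed.

End LocalCounts.

(** * Inequalities between consecutive degrees *)

Section DegreeInequalities.
Variable K : closedFieldType.
Variables (y : nat -> ratfun K) (a b c : nat -> K).
Hypothesis y_neq0 : forall j, y j != 0.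
Let d j := ratdeg (y j).

(** The conditions under which a zero at index j can produce a singularity that
    ends at index j + 2; they are symmetric under exchange of j and j + 2. *)
Definition confining (j : nat) : Prop :=
  [/\ a j.+1 = 0, c j.+2 = c j & b j + b j.+2 = b j.+1 *+ 2].

Lemma common_support j n : exists S : seq (option K), forall i, (i < n)%N ->
  d (j + i) = (\sum_(P <- S) zero_mult (y (j + i)) P)%N /\
  d (j + i) = (\sum_(P <- S) pole_mult (y (j + i)) P)%N.
Proof.
suff [r Hr] : exists r : seq (option K), forall S, uniq S -> {subset r <= S} ->
    forall i, (i < n)%N ->
      d (j + i) = (\sum_(P <- S) zero_mult (y (j + i)) P)%N /\
      d (j + i) = (\sum_(P <- S) pole_mult (y (j + i)) P)%N.
  exists (undup r); apply: Hr; first exact: undup_uniq.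
  by move=> P; rewrite mem_undup.
elim: n => [|n [r Hr]]; first by exists [::].
have [s Hs] := ratdeg_sum (y_neq0 (j + n)).
exists (s ++ r) => S uS sub i; rewrite ltnS leq_eqVlt => /predU1P[->|lt_in].
  by apply: Hs => // P Ps; apply: sub; rewrite mem_cat Ps.
by apply: Hr => // P Pr; apply: sub; rewrite mem_cat Pr orbT.
Qed.

Variable J : nat.
Hypothesis c_neq0 : forall j, (J <= j)%N -> c j != 0.
Hypothesis y_rec : forall j, (J <= j)%N ->
  y j.+2 + y j = recurrence_rhs (@ratconst K) (a j.+1) (b j.+1) (c j.+1) (y j.+1).

Lemma zero_le_poles_seq P j : (J <= j)%N ->
  (2 * zero_mult (y j.+1) P <= maxn (pole_mult (y j) P) (pole_mult (y j.+2) P))%N.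
Proof.
move=> Jj; apply: (zero_le_poles P _ (y_neq0 _) (y_rec Jj)).
by apply: c_neq0; apply: leqW.
Qed.

Lemma degree_convex j : (J <= j)%N -> (2 * d j.+1 <= d j + d j.+2)%N.
Proof.
move=> Jj; have [S HS] := common_support j 3.
move: (HS 0%N isT) (HS 1%N isT) (HS 2%N isT).
rewrite addn0 addn1 addn2 => -[_ ->] [-> _] [_ ->].
rewrite big_distrr -big_split /=; apply: leq_sum => P _.
apply: leq_trans (zero_le_poles_seq P Jj) _.
by rewrite geq_max leq_addr leq_addl.
Qed.

(** In terms of the slack e_i = d_(i-1) + d_(i+1) - 2 d_i, this says
    d_(j+3) <= e_(j+1) + e_(j+3) + e_(j+5). Pointwise, e_i is at least
    min(p_(i-1), p_(i+1)). If the poles at j + 2 and j + 4 both have order at least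
    that of the zero at j + 3, then e_(j+3) suffices. Otherwise one of them is
    small and the other is doubled, and [unconfined_pole], applied forwards or
    backwards in time, provides a further pole at j + 6 or at j. *)
Lemma degree_window j : (J <= j)%N -> ~ confining j.+1 -> ~ confining j.+3 ->
  (3 * d j.+3 + 2 * d j.+1 + 2 * d j.+1.+4
    <= d j + 2 * d j.+2 + 2 * d j.+4 + d j.+2.+4)%N.
Proof.
move=> Jj nconf1 nconf3; have [S HS] := common_support j 7.
move: (HS 0%N isT) (HS 1%N isT) (HS 2%N isT) (HS 3%N isT)
  (HS 4%N isT) (HS 5%N isT) (HS 6%N isT).
rewrite addn0 !addnS addn0 => -[_ ->] [-> _] [_ ->] [-> _] [_ ->] [-> _] [_ ->].
rewrite !big_distrr -!big_split /=; apply: leq_sum => P _.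
have J1 : (J <= j.+1)%N by lia.
have J2 : (J <= j.+2)%N by lia.
have J3 : (J <= j.+3)%N by lia.
have J4 : (J <= j.+4)%N by lia.
have Z1 := zero_le_poles_seq P Jj.
have Z3 := zero_le_poles_seq P J2.
have Z5 := zero_le_poles_seq P J4.
have F := unconfined_pole P (c_neq0 J3) (y_neq0 _) (y_neq0 _) (y_neq0 _)
  (y_rec J2) (y_rec J3) (y_rec J4) nconf3.
have rev i : (J <= i)%N -> y i + y i.+2
    = recurrence_rhs (@ratconst K) (a i.+1) (b i.+1) (c i.+1) (y i.+1).
  by rewrite addrC; exact: y_rec.
have nconf1' : ~ [/\ a j.+2 = 0, c j.+1 = c j.+3 & b j.+3 + b j.+1 = b j.+2 *+ 2].
  by case=> a0 c0 b0; apply: nconf1; split; rewrite // addrC.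
have G := unconfined_pole P (c_neq0 J3) (y_neq0 _) (y_neq0 _) (y_neq0 _)
  (rev _ J2) (rev _ J1) (rev _ Jj) nconf1'.
move: Z1 Z3 Z5 F G; clear.
move: (zero_mult (y j.+1) P) (zero_mult (y j.+3) P) (zero_mult (y j.+1.+4) P).
move: (pole_mult (y j) P) (pole_mult (y j.+2) P) (pole_mult (y j.+4) P)
  (pole_mult (y j.+2.+4) P) => p0 p2 p4 p6 z1 z3 z5; lia.
Qed.

End DegreeInequalities.

(** * Exponential growth *)

(** The slopes s_j = d_(j+1) - d_j are nondecreasing, and eventually nonnegative
    since d cannot decrease forever. The second hypothesis bounds d_(j+3) by the
    sum of three of the increments making up s_(j+5) - s_j, so that
    s_(j+5) >= d_(j+3) and d_(j+6) >= d_(j+5) + d_(j+3) >= 2 d_(j+3). *)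
Lemma convex_doubling (d : nat -> nat) (J : nat) :
    (forall j, (J <= j)%N -> (2 * d j.+1 <= d j + d j.+2)%N) ->
    (forall j, (J <= j)%N -> (3 * d j.+3 + 2 * d j.+1 + 2 * d j.+1.+4
      <= d j + 2 * d j.+2 + 2 * d j.+4 + d j.+2.+4)%N) ->
  exists i, forall j, (i <= j)%N -> (2 * d j <= d (j + 3))%N.
Proof.
move=> convex window.
have descent m : forall i, (J <= i)%N -> (d i <= m)%N ->
    exists2 k, (J <= k)%N & (d k <= d k.+1)%N.
  elim: m => [|m IH] i Ji dim; first by exists i; rewrite // (leq_trans dim).
  have [le|lt] := leqP (d i) (d i.+1); first by exists i.
  by apply: (IH i.+1); [exact: leqW | rewrite -ltnS; apply: leq_trans dim].
have [k Jk dk] := descent (d J) J (leqnn _) (leqnn _).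
have mono n : (d (k + n) <= d (k + n).+1)%N.
  elim: n => [|n IH]; first by rewrite addn0.
  have := convex (k + n)%N (leq_trans Jk (leq_addr _ _)).
  by rewrite addnS; move: IH; lia.
exists (k + 3)%N => j kj.
have [n ->] : exists n, j = (k + n + 3)%N by exists (j - k - 3)%N; lia.
have := window (k + n)%N (leq_trans Jk (leq_addr _ _)).
have := mono n; have := mono n.+3; have := mono n.+4.
have := mono n.+2; have := mono n.+1; have := mono n.+1.+4.
have c1 := convex (k + n)%N (leq_trans Jk (leq_addr _ _)).
have c2 := convex (k + n.+1)%N (leq_trans Jk (leq_addr _ _)).
have c3 := convex (k + n.+2)%N (leq_trans Jk (leq_addr _ _)).
have c4 := convex (k + n.+3)%N (leq_trans Jk (leq_addr _ _)).
have c5 := convex (k + n.+4)%N (leq_trans Jk (leq_addr _ _)).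
move: c1 c2 c3 c4 c5; rewrite !addnS !addn0; lia.
Qed.

Lemma doubling_expn (d : nat -> nat) (i : nat) : (0 < d i)%N ->
  (forall j, (i <= j)%N -> (2 * d j <= d (j + 3))%N) ->
  forall n, (2 ^ n <= d (i + 3 * n))%N.
Proof.
move=> d0 double; elim=> [|n IH]; first by rewrite muln0 addn0.
rewrite expnS mulnSr addnA; apply: leq_trans (double _ (leq_addr _ _)).
by rewrite leq_mul2l.
Qed.

Lemma poly_power_bound (R : realFieldType) (p : {poly R}) (x : R) : 1 <= x ->
  p.[x] <= (\sum_(i < size p) `|p`_i|) * x ^+ size p.
Proof.
move=> x1; rewrite horner_coef big_distrl /=; apply: ler_sum => i _.
apply: le_trans (ler_norm _) _; rewrite normrM normrX (ger0_norm (le_trans ler01 x1)).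
by apply: ler_wpM2l => //; apply: ler_weXn2l => //; exact: ltnW.
Qed.

(** At an argument that is a multiple (k + 1) n of k + 1, the power of two is at least
    n^(k+1), while a polynomial of size k along an arithmetic progression is
    O(n^k). *)
Lemma expn_not_poly_bounded (R : archiRealFieldType) (p : {poly R}) (i m : nat) :
  ~ (forall n, (2 ^ n)%N%:R <= p.[(i + m.+1 * n)%N%:R]).
Proof.
move=> bound; set k := size p; set M := \sum_(j < k) `|p`_j|.
pose L := (i + m.+1 * k.+1).+1.
have M0 : 0 <= M by apply: sumr_ge0.
have [N HN] : exists N : nat, M * L%:R ^+ k < N%:R.
  exists (Num.trunc (M * L%:R ^+ k)).+1; apply: truncnS_gt.
pose n := N.+1.
have : ((n ^ k.+1)%N%:R : R) <= M * ((L * n) ^ k)%N%:R.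
  apply: (@le_trans _ _ (2 ^ (k.+1 * n))%N%:R).
    by rewrite ler_nat mulnC expnM leq_exp2r // ltnW // ltn_expl.
  apply: le_trans (bound _) _; set x := (_ + _)%N.
  have x0 : (0 < x)%N by rewrite /x; lia.
  apply: le_trans (poly_power_bound _ _) _; first by rewrite ler1n.
  rewrite -/k -/M natrX; apply: ler_wpM2l => //; rewrite lerXn2r ?nnegrE //.
  rewrite ler_nat /x /L /n; nia.
rewrite expnS expnMn !natrM !natrX mulrA ler_pM2r ?exprn_gt0 ?ltr0n //.
move=> H; have := le_lt_trans H HN; rewrite ltr_nat /n; lia.
Qed.

(** * Rational functions at large integers *)

Section RationalSequences.
Variable K : numClosedFieldType.
Implicit Types (s : nat -> K) (p q : {poly K}) (f : ratfun K).

Definition frequently (Q : nat -> Prop) := forall J, exists2 j, (J <= j)%N & Q j.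
Definition eventually (Q : nat -> Prop) := exists J, forall j, (J <= j)%N -> Q j.

Lemma frequently_eventually (Q1 Q2 : nat -> Prop) :
  frequently Q1 -> eventually Q2 -> frequently (fun j => Q1 j /\ Q2 j).
Proof.
move=> F [I HI] J; have [j Hj Qj] := F (maxn I J).
by move: Hj; rewrite geq_max => /andP[Ij Jj]; exists j => //; split=> //; apply: HI.
Qed.

Lemma eventually_and (Q1 Q2 : nat -> Prop) :
  eventually Q1 -> eventually Q2 -> eventually (fun j => Q1 j /\ Q2 j).
Proof.
move=> [I HI] [J HJ]; exists (maxn I J) => j; rewrite geq_max => /andP[Ij Jj].
by split; [apply: HI | apply: HJ].
Qed.

Lemma poly_eventually_neq0 p : p != 0 -> eventually (fun j => p.[j%:R] != 0).
Proof.
move=> p0; have [r Er _] := mup_roots p0.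
suff [J HJ] : eventually (fun j => j%:R \notin r).
  exists J => j Jj; rewrite Er hornerZ mulf_neq0 ?lead_coef_eq0 //.
  by rewrite -/(root _ _) root_prod_XsubC HJ.
elim: r {Er} => [|z r IH]; first by exists 0%N.
have [J HJ] : eventually (fun j => j%:R != z).
  have [[k <-]|no] := pselect (exists k : nat, k%:R = z).
    by exists k.+1 => j; rewrite eqr_nat; case: eqVneq => // ->; rewrite ltnn.
  by exists 0%N => j _; apply/eqP => jz; apply: no; exists j.
have [I HI] := eventually_and IH (ex_intro _ J HJ).
by exists I => j /HI[jr jz]; rewrite in_cons negb_or jz.
Qed.

Lemma poly_frequently_eq0 p : frequently (fun j => p.[j%:R] = 0) -> p = 0.
Proof.
move=> F; apply/eqP/negPn/negP => /poly_eventually_neq0 E.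
by have [j _ [-> /eqP]] := frequently_eventually F E 0%N.
Qed.

(** The values of a rational function, without division: the sequence is arbitrary
    at the roots of q, so this class is stable under all the operations used. *)
Definition rational_seq s := exists p q,
  q != 0 /\ forall j, q.[j%:R] * s j = p.[j%:R].

(** A rational function with infinitely many integer zeros vanishes, which turns a
    condition met infinitely often into one met at all large indices. *)
Lemma rational_seq_eq0 s : rational_seq s ->
  frequently (fun j => s j = 0) -> eventually (fun j => s j = 0).
Proof.
move=> [p [q [q0 E]]] F.
have p0 : p = 0.
  apply: poly_frequently_eq0 => J; have [j Jj sj] := F J; exists j => //.
  by rewrite -E sj mulr0.
have [J HJ] := poly_eventually_neq0 q0; exists J => j /HJ qj.
by apply: (mulfI qj); rewrite E p0 horner0 mulr0.
Qed.

Lemma rational_seqD s1 s2 : rational_seq s1 -> rational_seq s2 ->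
  rational_seq (fun j => s1 j + s2 j).
Proof.
move=> [p1 [q1 [q10 E1]]] [p2 [q2 [q20 E2]]].
exists (q2 * p1 + q1 * p2), (q1 * q2); split; first by rewrite mulf_neq0.
by move=> j; rewrite hornerD !hornerM -E1 -E2; ring.
Qed.

Lemma rational_seqZ k s : rational_seq s -> rational_seq (fun j => k * s j).
Proof.
move=> [p [q [q0 E]]]; exists (k *: p), q; split=> // j.
by rewrite hornerZ -E; ring.
Qed.

Lemma rational_seq_shift s : rational_seq s -> rational_seq (fun j => s j.+1).
Proof.
move=> [p [q [q0 E]]]; exists (p \Po ('X + 1%:P)), (q \Po ('X + 1%:P)).
split; last by move=> j; rewrite !horner_comp !hornerE natr1 E.
by rewrite comp_poly2_eq0 // size_XaddC.
Qed.

Definition ratfun_seq f (j : nat) : K := (rnum f).[j%:R] / (rden f).[j%:R].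

Lemma rational_ratfun_seq f : rational_seq (ratfun_seq f).
Proof.
(* At a root of the denominator ratfun_seq f is 0, so the fraction is multiplied
   through by the square of the denominator to make both sides vanish there. *)
exists (rden f * rnum f), (rden f * rden f).
split; first by rewrite mulf_neq0 ?rden_neq0.
move=> j; rewrite /ratfun_seq !hornerM.
have [->|d0] := eqVneq (rden f).[j%:R] 0; first by rewrite !mul0r.
by field.
Qed.

Lemma has_value_ratfun_seq f :
  eventually (fun j => has_value f j%:R (ratfun_seq f j)).
Proof.
have [J HJ] := poly_eventually_neq0 (rden_neq0 f).
exists J => j /HJ dj; exists (rnum f), (rden f); split=> //; exact: ratfunE.
Qed.

Lemma ratfun_seq_neq0 f : f != 0 -> eventually (fun j => ratfun_seq f j != 0).
Proof.
move=> f0; have En := poly_eventually_neq0 (rnum_neq0 f0).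
have [J HJ] := eventually_and En (poly_eventually_neq0 (rden_neq0 f)).
by exists J => j /HJ[nj dj]; rewrite mulf_neq0 ?invr_eq0.
Qed.

Lemma ratfun_seq_poly f p : frequently (fun j => ratfun_seq f j = p.[j%:R]) ->
  forall x, has_value f x p.[x].
Proof.
move=> F; have Ed := poly_eventually_neq0 (rden_neq0 f).
have /eqP : rnum f - p * rden f = 0.
  apply: poly_frequently_eq0 => J.
  have [j Jj [Ej dj]] := frequently_eventually F Ed J; exists j => //.
  by rewrite !hornerE -Ej /ratfun_seq divfK // subrr.
rewrite subr_eq0 => /eqP Enum x; exists p, 1; split.
- rewrite [LHS]ratfunE Enum tofracM mulfK ?tofrac_eq0 ?rden_neq0 //.
  by rewrite tofrac1 divr1.
- by rewrite hornerC oner_neq0.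
- by rewrite hornerC divr1.
Qed.

End RationalSequences.

(** * The confinement conditions and the theorem *)

(** Polynomial growth of the degree forces the confinement conditions infinitely
    often: otherwise the degree doubles every three steps. *)
Lemma frequently_confining (R : realType) (a b c : ratfun R[i])
    (y : nat -> ratfun R[i]) : c <> 0 ->
    (forall j, nonconstant (y j)) ->
    (forall (j : nat) (aj bj cj : R[i]), (0 < j)%N ->
       has_value a j%:R aj -> has_value b j%:R bj -> has_value c j%:R cj ->
       y j.+1 + y j.-1 =
         (ratconst aj * y j ^+ 2 + ratconst bj * y j + ratconst cj) / y j ^+ 2) ->
    (exists P : {poly R}, forall j, (ratdeg (y j))%:R <= P.[j%:R]) ->
  frequently (confining (ratfun_seq a) (ratfun_seq b) (ratfun_seq c)).
Proof.
move=> /eqP c0 ync yeq [Q HQ] J; apply: contrapT => nfreq.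
have [I HI] := eventually_and
  (eventually_and (has_value_ratfun_seq a) (has_value_ratfun_seq b))
  (eventually_and (has_value_ratfun_seq c) (ratfun_seq_neq0 c0)).
have y0 j : y j != 0.
  by apply/eqP => yj; apply: (ync j 0); rewrite yj rmorph0.
pose M := maxn I J.
have cM j : (M <= j)%N -> ratfun_seq c j != 0.
  by move=> Mj; have [] := HI j (leq_trans (leq_maxl _ _) Mj); case=> _ _ [].
have yM j : (M <= j)%N -> y j.+2 + y j = recurrence_rhs (@ratconst R[i])
    (ratfun_seq a j.+1) (ratfun_seq b j.+1) (ratfun_seq c j.+1) (y j.+1).
  move=> Mj; have Ij : (I <= j.+1)%N by rewrite leqW // (leq_trans (leq_maxl _ _) Mj).
  by have [[va vb] [vc _]] := HI _ Ij; exact: (yeq j.+1 _ _ _ isT va vb vc).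
have nconf j : (M <= j)%N ->
    ~ confining (ratfun_seq a) (ratfun_seq b) (ratfun_seq c) j.
  by move=> Mj Cj; apply: nfreq; exists j => //; apply: leq_trans (leq_maxr _ _) Mj.
have [i Hi] := @convex_doubling (fun j => ratdeg (y j)) M
  (fun j Mj => degree_convex y0 cM yM Mj)
  (fun j Mj => degree_window y0 cM yM Mj (nconf _ (leqW Mj))
     (nconf _ (leqW (leqW (leqW Mj))))).
apply: (@expn_not_poly_bounded R Q i 2) => n.
apply: le_trans (HQ _); rewrite ler_nat.
by apply: (doubling_expn (d := fun j => ratdeg (y j))) => //; apply: ratdeg_gt0.
Qed.

Theorem theorem3p1 (R : realType) (a b c : ratfun R[i]) (y : nat -> ratfun R[i])
  (c_neq0 : c <> 0)
  (y_nonconst : forall j : nat, nonconstant (y j))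
  (y_eq : forall (j : nat) (aj bj cj : R[i]), (0 < j)%N ->
     has_value a j%:R aj -> has_value b j%:R bj -> has_value c j%:R cj ->
     y j.+1 + y j.-1 =
       (ratconst aj * y j ^+ 2 + ratconst bj * y j + ratconst cj) / y j ^+ 2)
  (y_growth : exists P : {poly R}, forall j : nat, (ratdeg (y j))%:R <= P.[j%:R]) :
  exists A B C D : R[i], forall j : nat,
    [/\ has_value a j%:R 0,
        has_value b j%:R (A * j%:R + B)
      & has_value c j%:R (C + D * (-1) ^+ j)].
Proof.
have F := frequently_confining c_neq0 y_nonconst y_eq y_growth.
have a0 : frequently (fun j => ratfun_seq a j = (0 : {poly R[i]}).[j%:R]).
  move=> J; have [j Jj [aj _ _]] := F J.
  by exists j.+1; [exact: leqW | rewrite horner0].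
(* The recurring condition at j, j + 2 becomes an identity at all large j. *)
have [I HI] : eventually (fun j => ratfun_seq c j.+2 + -1 * ratfun_seq c j = 0).
  apply: rational_seq_eq0.
    have rc := rational_ratfun_seq c.
    exact: rational_seqD (rational_seq_shift (rational_seq_shift rc))
             (rational_seqZ _ rc).
  by move=> J; have [j Jj [_ cj _]] := F J; exists j; rewrite // cj; ring.
have [J HJ] : eventually (fun j =>
    ratfun_seq b j.+2 + (ratfun_seq b j + -2 * ratfun_seq b j.+1) = 0).
  apply: rational_seq_eq0.
    have rb := rational_ratfun_seq b.
    exact: rational_seqD (rational_seq_shift (rational_seq_shift rb))
             (rational_seqD rb (rational_seqZ _ (rational_seq_shift rb))).
  move=> J; have [j Jj [_ _ bj]] := F J; exists j; rewrite // addrA.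
  by rewrite [X in X + _]addrC bj; ring.
pose C := ratfun_seq c I.
have cC n : ratfun_seq c (I + n.*2) = C.
  elim: n => [|n IH]; first by rewrite addn0.
  have := HI (I + n.*2)%N (leq_addr _ _); rewrite IH doubleS !addnS.
  by move/eqP; rewrite mulN1r subr_eq0 => /eqP.
pose A := ratfun_seq b J.+1 - ratfun_seq b J; pose B := ratfun_seq b J - A * J%:R.
have bAB n : ratfun_seq b (J + n) = A * (J + n)%:R + B /\
             ratfun_seq b (J + n).+1 = A * (J + n).+1%:R + B.
  elim: n => [|n [IH1 IH2]].
    by rewrite addn0 /B /A -natr1; split; ring.
  rewrite addnS; split=> //.
  have := HJ (J + n)%N (leq_addr _ _); rewrite IH1 IH2 => H.
  apply/eqP; rewrite -subr_eq0; apply/eqP; rewrite -[RHS]H -!natr1; ring.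
have vc x : has_value c x C%:P.[x].
  apply: ratfun_seq_poly => k; exists (I + k.*2)%N; last by rewrite hornerC cC.
  by rewrite -addnn; lia.
have vb x : has_value b x (A *: 'X + B%:P).[x].
  apply: ratfun_seq_poly => k; exists (J + k)%N; first exact: leq_addl.
  by rewrite (bAB k).1 !hornerE.
exists A, B, C, 0 => j; split.
- by have := ratfun_seq_poly a0 j%:R; rewrite horner0.
- by have := vb j%:R; rewrite !hornerE.
- by have := vc j%:R; rewrite hornerC mul0r addr0.
Qed.
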